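(* Let $N\ge2$ and let $j$ be an integer with $1\le j$ and $2j\le N$. Then \begin{align*} \mathcal{I}^{\mathsf{DB}}_N&=\{y\in\mathbb{R}^N_0:\ \|y\|_{\mathsf{spr}}\le N\},\\ \mathcal{I}^{\mathsf{CS}}_N&=\{y\in\mathbb{R}^N_0:\ \|y\|_1\le2\tau_N\},\\ \mathcal{I}^{\mathsf{CS}}_{N,j}&=\{y\in\mathbb{R}^N_0:\ \max(j^{-1}\|y\|_1,\,2\|y\|_\infty)\le2\tau_{N,j}\},\\ \mathcal{C}^{\mathsf{DB}}_N&=\Big\{y\in\mathbb{R}^N_0:\ \max_{k\in\{1,\dots,N-1\}}\ \max_{S\subseteq\{1,\dots,N\},\,|S|=k}\frac{\sum_{l\in S}y_l}{k(N-k)}\le1\Big\},\\ \mathcal{C}^{\mathsf{CS}}_N&=\{y\in\mathbb{R}^N_0:\ \|y\|_{\mathsf{spr}}\le2\tau_N\},\\ \mathcal{C}^{\mathsf{CS}}_{N,j}&=\Big\{y\in\mathbb{R}^N_0:\ \sum_{l=1}^j y_{\mathsf{max},l}-\sum_{l=1}^j y_{\mathsf{min},l}\le2j\,\tau_{N,j}\Big\}. \end{align*} Moreover, $$\bigcap_{j=1}^{\lfloor N/2\rfloor}\mathcal{C}^{\mathsf{CS}}_{N,j}=\Big\{y\in\mathbb{R}^N_0:\ \max_{k\in\{1,\dots,\lfloor N/2\rfloor\}}\ \max_{|S_1|=k,\,|S_2|=k}\frac{\sum_{i\in S_1}y_i-\sum_{i\in S_2}y_i}{2k\,\tau_{N,k}}\le1\Big\},$$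 where $S_1,S_2$ range over subsets of $\{1,\dots,N\}$.
   Context: $\mathbb{R}^N_0=\{x\in\mathbb{R}^N:\sum_{i=1}^N x_i=0\}$, with the Euclidean inner product. For $x\in\mathbb{R}^N$, $\mathrm{Sym}(x)$ is the set of all vectors obtained from $x$ by permuting its coordinates; $a^{(k)}$ means the entry $a$ repeated $k$ times. Define: - $R^{\mathsf{DB}}_N=\bigcup_{k=1}^{N-1}\mathrm{Sym}\big((N-k)^{(k)},(-k)^{(N-k)}\big)$; - $\tau_N=\max_{\varphi\in\mathbb{R}}[(N-2)\sin\varphi+\sin2\varphi]$ and $R^{\mathsf{CS}}_N=\mathrm{Sym}(\tau_N(1,-1,0,\dots,0))$; - for $1\le j\le N/2$, $\tau_{N,j}=\max_{\varphi\in\mathbb{R}}[(N-2j)\sin\varphi+j\sin2\varphi]$ and $R^{\mathsf{CS}}_{N,j}=\mathrm{Sym}\big(\tau_{N,j}(1^{(j)},(-1)^{(j)},0^{(N-2j)})\big)$. For a finite set $R\subset\mathbb{R}^N_0$ of nonzero vectors, $\mathcal{I}(R)$ is the convex hull of $R$ and $\mathcal{C}(R)=\bigcap_{x\in R}\{y\in\mathbb{R}^N_0:\langle y,x\rangle\le\langle x,x\rangle\}$. Write $\mathcal{I}^{\mathsf{DB}}_N=\mathcal{I}(R^{\mathsf{DB}}_N)$, $\mathcal{C}^{\mathsf{DB}}_N=\mathcal{C}(R^{\mathsf{DB}}_N)$, $\mathcal{I}^{\mathsf{CS}}_N=\mathcal{I}(R^{\mathsf{CS}}_N)$, $\mathcal{C}^{\mathsf{CS}}_N=\mathcal{C}(R^{\mathsf{CS}}_N)$,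 $\mathcal{I}^{\mathsf{CS}}_{N,j}=\mathcal{I}(R^{\mathsf{CS}}_{N,j})$, $\mathcal{C}^{\mathsf{CS}}_{N,j}=\mathcal{C}(R^{\mathsf{CS}}_{N,j})$. For $y\in\mathbb{R}^N$: $y_{\mathsf{max},l}$ and $y_{\mathsf{min},l}$ are the $l$-th largest and $l$-th smallest entries of $y$ (counted with multiplicity); $\|y\|_{\mathsf{spr}}=\max_i y_i-\min_i y_i$; $\|y\|_1=\sum_i|y_i|$; $\|y\|_\infty=\max_i|y_i|$. *)

(* Defs.v *)
From HB Require Import structures.
From mathcomp Require Import all_boot all_order all_algebra perm.
From mathcomp Require Import all_classical all_reals all_analysis.

Set Implicit Arguments.
Unset Strict Implicit.
Unset Printing Implicit Defensive.

Import Order.TTheory GRing.Theory Num.Theory numFieldNormedType.Exports.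

Local Open Scope classical_set_scope.
Local Open Scope ring_scope.

Section Polytopes.
Context {R : realType}.
Implicit Types (N j k l : nat).

Definition zero_sum N : set 'rV[R]_N := [set y | \sum_i y 0 i = 0].

Definition dot N (x y : 'rV[R]_N) : R := \sum_i x 0 i * y 0 i.

Definition Sym N (x : 'rV[R]_N) : set 'rV[R]_N :=
  [set col_perm s x | s in [set: 'S_N]].

Definition convex_hull N (A : set 'rV[R]_N) : set 'rV[R]_N :=
  smallest (@convex_set R 'rV[R]_N) A.

Definition polyI N (A : set 'rV[R]_N) : set 'rV[R]_N := convex_hull A.

Definition polyC N (A : set 'rV[R]_N) : set 'rV[R]_N :=
  \bigcap_(x in A) [set y | zero_sum y /\ dot y x <= dot x x].

(* The suprema below are maxima, see [sup_sin_sin2_attained]. *)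
Definition tau N : R :=
  sup [set (N%:R - 2) * sin phi + sin (2 * phi) | phi in [set: R]].

Definition tauj N j : R :=
  sup [set (N%:R - 2 * j%:R) * sin phi + j%:R * sin (2 * phi)
      | phi in [set: R]].

Definition R_DB N : set 'rV[R]_N :=
  \bigcup_(k in [set k | (1 <= k < N)%N])
    Sym (\row_(i < N) if (i < k)%N then N%:R - k%:R else - k%:R).

Definition R_CS N : set 'rV[R]_N :=
  Sym (tau N *: \row_(i < N)
         if i == 0%N :> nat then 1 else if i == 1%N :> nat then -1 else 0).

Definition R_CSj N j : set 'rV[R]_N :=
  Sym (tauj N j *: \row_(i < N)
         if (i < j)%N then 1 else if (i < 2 * j)%N then -1 else 0).

Definition I_DB N := polyI (@R_DB N).
Definition C_DB N := polyC (@R_DB N).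
Definition I_CS N := polyI (@R_CS N).
Definition C_CS N := polyC (@R_CS N).
Definition I_CSj N j := polyI (@R_CSj N j).
Definition C_CSj N j := polyC (@R_CSj N j).

(* The l-th largest and l-th smallest entries, for 1 <= l <= N. *)
Definition ymax N (y : 'rV[R]_N) l : R := nth 0 (sort >=%R (codom (y 0))) l.-1.
Definition ymin N (y : 'rV[R]_N) l : R := nth 0 (sort <=%R (codom (y 0))) l.-1.

(* For N > 0 these are the largest and smallest entries of y. *)
Definition norm_spr N (y : 'rV[R]_N) : R :=
  sup (range (y 0)) - inf (range (y 0)).

Definition norm1 N (y : 'rV[R]_N) : R := \sum_i `|y 0 i|.

(* The library's norm on matrices is the maximum of the absolute values of the
   entries. *)
Definition norm_infty N (y : 'rV[R]_N) : R := `|y|.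

Lemma sup_sin_sin2_attained (a b : R) :
  exists phi, a * sin phi + b * sin (2 * phi) =
    sup [set a * sin phi + b * sin (2 * phi) | phi in [set: R]].
Proof.
pose f x := a * sin x + b * sin (2 * x); rewrite -/(f _).
have fper : periodic f (pi *+ 2).
  move=> x; rewrite /f sinD2pi mulrDr mulr_natl.
  by rewrite (mulr_natl _ 2) (mulr2n (pi *+ 2)) addrA !sinD2pi.
have fperN n x : f (x - (pi *+ 2) *+ n) = f x.
  by rewrite -[LHS](periodicn fper n) subrK.
have cf : continuous f.
  move=> x; apply: cvgD; apply: cvgM; try exact: cvg_cst.
    exact: continuous_sin.
  apply: (@cvg_comp _ _ _ (fun x => 2 * x) sin _ (nbhs (2 * x))).
    by apply: cvgM; [exact: cvg_cst|exact: cvg_id].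
  exact: continuous_sin.
have p0 : 0 < (pi *+ 2 : R) by rewrite mulrn_wgt0// pi_gt0.
have [c cI cM] := EVT_max (ltW p0) (continuous_subspaceT cf).
have cmax x : f x <= f c.
  pose m := Num.floor (x / (pi *+ 2)).
  pose z := x - m%:~R * (pi *+ 2).
  have zI : z \in `[0, pi *+ 2].
    have /andP[] := floor_itv (x / (pi *+ 2)).
    rewrite -/m ler_pdivlMr// ltr_pdivrMr// => h1 h2.
    rewrite in_itv /= subr_ge0 h1 /= lerBlDr.
    by rewrite (le_trans (ltW h2))// intrD mulrDl mul1r addrC.
  suff <- : f z = f x by exact: cM.
  rewrite /z; case: m {z zI} => n.
    by rewrite -pmulrn mulr_natl fperN.
  by rewrite NegzE mulrNz mulNr opprK -pmulrn mulr_natl (periodicn fper).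
exists c; apply/eqP; rewrite eq_le; apply/andP; split.
  apply: ub_le_sup; last by exists c.
  by exists (f c) => _ [x _ <-]; exact: cmax.
apply: ge_sup; first by exists (f c); exists c.
by move=> _ [x _ <-]; exact: cmax.
Qed.

End Polytopes.

Arguments zero_sum {R} N.
Arguments tau R N : clear implicits.
Arguments tauj R N j : clear implicits.
Arguments I_DB R N : clear implicits.
Arguments C_DB R N : clear implicits.
Arguments I_CS R N : clear implicits.
Arguments C_CS R N : clear implicits.
Arguments I_CSj R N j : clear implicits.
Arguments C_CSj R N j : clear implicits.

(* Main.v *)
(** Both families of convex hulls come from integrality arguments.  For DB, the
    map [z |-> N z - (sum z) 1] sends the vertices of the cube to the generators
    (and to [0]), and it sends [(y - min y) / N] to [y].  For CS with
    parameter [j], after scaling by [tauj] the claim is that a zero-sum point of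
    the cube [-1, 1]^N with l1 norm at most [2 j] is a convex combination of the
    vectors [1_A - 1_B] with [A], [B] disjoint of size [j].  Moving along
    [e_a - e_b] in both directions, where [a], [b] are coordinates in the open
    interval, reduces to l1 norm exactly [2 j]; there the positive and negative
    parts are points of hypersimplices, whose vertices are indicators.  The
    circumscribed polytopes are computed by evaluating the inner products, using
    that sums over [j]-subsets are extremal on the [j] largest and the [j]
    smallest entries. *)
Require Import Defs.
From mathcomp Require Import all_boot all_order all_algebra perm.
From mathcomp Require Import all_classical all_reals all_analysis.
From mathcomp Require Import ring lra zify.
Import Order.TTheory GRing.Theory Num.Theory numFieldNormedType.Exports.
Local Open Scope classical_set_scope.
Local Open Scope ring_scope.

(** * Convex sets and convex hulls *)

Section ConvexSets.
Context {R : realType} {N : nat}.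
Implicit Types (C : set 'rV[R]_N) (x y : 'rV[R]_N).

Lemma convex_setP C :
  @convex_set R 'rV[R]_N C <->
  forall x y (t : R), C x -> C y -> 0 <= t <= 1 -> C (t *: x + (1 - t) *: y).
Proof.
split=> [Ccvx x y t Cx Cy /andP[t0 t1]|Ccvx x y t /set_mem Cx /set_mem Cy].
  by have := Ccvx x y (Itv01 t0 t1); rewrite !inE; apply.
by apply/mem_set; apply: Ccvx => //; rewrite ge0/= le1.
Qed.

(** Lets a vertex argument act on one summand of a point, or on a rescaled point, while the rest
    stays fixed. *)
Lemma convex_set_affine_preimage C x (c : R) :
  @convex_set R 'rV[R]_N C -> @convex_set R 'rV[R]_N [set v | C (x + c *: v)].
Proof.
move=> /convex_setP Ccvx; apply/convex_setP => u v t /= Cu Cv t01.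
have := Ccvx _ _ _ Cu Cv t01; congr C.
by apply/rowP => i; rewrite !mxE; ring.
Qed.

(** [y] is the combination of the two displaced points with weights [u / (t + u)] and
    [t / (t + u)]. *)
Lemma convex_set_between C y (d : 'rV[R]_N) (t u : R) :
  @convex_set R 'rV[R]_N C -> 0 < t -> 0 < u ->
  C (y + t *: d) -> C (y - u *: d) -> C y.
Proof.
move=> /convex_setP Ccvx t0 u0 Ct Cu.
have tu : t + u != 0 by rewrite gt_eqF// addr_gt0.
have uI : 0 <= u / (t + u) <= 1.
  rewrite ler_pdivrMr ?addr_gt0// mul1r lerDr (ltW t0) andbT.
  by rewrite divr_ge0 ?ltW ?addr_gt0.
have := Ccvx _ _ _ Ct Cu uI; congr C; apply/rowP => i; rewrite !mxE; field.
by [].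
Qed.

End ConvexSets.

Section ConvexHull.
Context {R : realType} {N : nat}.
Implicit Types (A B : set 'rV[R]_N).

Lemma sub_convex_hull A : A `<=` convex_hull A.
Proof. exact: sub_gen_smallest. Qed.

Lemma convex_hull_convex A : @convex_set R 'rV[R]_N (convex_hull A).
Proof.
apply/convex_setP => x y t Ax Ay t01 B [Bcvx AB].
by move/convex_setP: (Bcvx); apply => //; [apply: Ax|apply: Ay].
Qed.

Lemma convex_hull_sub A B :
  @convex_set R 'rV[R]_N B -> A `<=` B -> convex_hull A `<=` B.
Proof. exact: smallest_sub. Qed.

End ConvexHull.

(** * Vertices of the cube and of hypersimplices *)

Definition indicator_row {R : realType} {N : nat} (S : {set 'I_N}) : 'rV[R]_N :=
  \row_i (i \in S)%:R.

Section IntegralPoints.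
Context {R : realType} {N : nat}.
Implicit Types (C : set 'rV[R]_N) (y z : 'rV[R]_N).

Lemma sum_indicator_row (S : {set 'I_N}) :
  \sum_i (indicator_row S : 'rV[R]_N) 0 i = #|S|%:R.
Proof.
rewrite -sum1_card natr_sum [RHS]big_mkcond /=.
by apply: eq_bigr => i _; rewrite mxE; case: (i \in S).
Qed.

(** Induction on the number of fractional coordinates: [z] lies between the two points obtained by
    moving one of them to 0 and to 1. *)
Lemma cube_sub_convex C z :
  @convex_set R 'rV[R]_N C -> (forall S, C (indicator_row S)) ->
  (forall i, 0 <= z 0 i <= 1) -> C z.
Proof.
move=> Ccvx CS; have [n] := ubnP #|[set i | 0 < z 0 i < 1]%SET|.
elim: n z => // n IH z zn z01.
have [/existsP[a /andP[a0 a1]]|/existsPn nofrac] :=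
  boolP [exists i, 0 < z 0 i < 1]; last first.
  suff -> : z = indicator_row [set i | z 0 i == 1]%SET by [].
  apply/rowP => i; rewrite mxE inE; case: eqVneq => [//|zi1].
  have := nofrac i; have /andP[z0 z1] := z01 i.
  by rewrite (lt_neqAle _ 1) zi1 z1 !andbT -leNgt => zi0; apply/le_anti/andP.
have step (c : R) : z 0 a + c = 0 \/ z 0 a + c = 1 ->
    C (z + c *: delta_mx 0 a).
  move=> cE; apply: IH => [|i]; last first.
    rewrite !mxE eqxx/=; have := z01 i; case: eqVneq => [->|_].
      by rewrite mulr1; case: cE => ->; rewrite !(lexx, ler01).
    by rewrite mulr0 addr0.
  rewrite -ltnS; apply: leq_trans zn; rewrite ltnS; apply/proper_card.
  apply/properP; split; last first.
    exists a; rewrite !inE ?a0//= !mxE !eqxx mulr1.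
    by case: cE => ->; rewrite ltxx ?andbF.
  apply/fintype.subsetP => i; rewrite !inE !mxE eqxx/=.
  case: eqVneq => [->|_]; last by rewrite mulr0 addr0.
  by rewrite mulr1; case: cE => ->; rewrite ltxx ?andbF.
apply: (convex_set_between _ _ (delta_mx 0 a) (1 - z 0 a) (z 0 a) Ccvx) => //.
- by rewrite subr_gt0.
- by apply: step; right; ring.
- by rewrite -scaleNr; apply: step; left; ring.
Qed.

(** Symmetric in [a] and [b], so that one shifting claim, used twice with the roles exchanged,
    supplies both premises. *)
Lemma convex_set_shift C y (a b : 'I_N) (t u : R) :
  @convex_set R 'rV[R]_N C -> 0 < t -> 0 < u ->
  C (y + t *: (delta_mx 0 a - delta_mx 0 b)) ->
  C (y + u *: (delta_mx 0 b - delta_mx 0 a)) -> C y.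
Proof.
move=> Ccvx t0 u0 Ct Cu.
apply: (convex_set_between _ _ _ _ _ Ccvx t0 u0 Ct).
by rewrite -scalerN opprB.
Qed.

(* A point with a non-integral coordinate has two of them, as the sum is an
   integer; it can be moved along [e_a - e_b] both ways until one of them
   becomes integral. *)
Lemma hypersimplex_sub_convex (k : nat) C y :
  @convex_set R 'rV[R]_N C ->
  (forall A : {set 'I_N}, #|A| = k -> (forall i, i \in A -> 0 < y 0 i) ->
    C (indicator_row A)) ->
  (forall i, 0 <= y 0 i <= 1) -> \sum_i y 0 i = k%:R -> C y.
Proof.
move=> Ccvx; have [n] := ubnP #|[set i | 0 < y 0 i < 1]%SET|.
elim: n y => // n IH y yn CA y01 ysum.
have intE i : (0 < y 0 i < 1) = false -> y 0 i = (y 0 i == 1)%:R.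
  have := y01 i => /andP[i0 i1]; case: eqVneq => [//|yi1].
  rewrite (lt_neqAle _ 1) yi1 i1 !andbT => /negbT; rewrite -leNgt => yi0.
  by apply/le_anti/andP.
have [/existsP[a fa]|/existsPn nofrac] :=
    boolP [exists i, 0 < y 0 i < 1]; last first.
  have yE : y = indicator_row [set i | y 0 i == 1]%SET.
    by apply/rowP => i; rewrite mxE inE -intE//; exact/negbTE/nofrac.
  rewrite yE; apply: CA => [|i]; last by rewrite inE => /eqP ->.
  by move: ysum; rewrite {1}yE sum_indicator_row => /eqP; rewrite eqr_nat => /eqP.
have [/existsP[b /andP[ba fb]]|/existsPn onlya] :=
    boolP [exists b, (b != a) && (0 < y 0 b < 1)]; last first.
  exfalso; have yE : \sum_i y 0 i = y 0 a + #|[set i in predC1 a | y 0 i == 1]%SET|%:R.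
    rewrite (bigD1 a)//= -sum1_card natr_sum; congr +%R.
    rewrite [RHS]big_mkcond [LHS]big_mkcond/=; apply: eq_bigr => i _.
    rewrite !inE; have := onlya i; case: eqVneq => //= ia /negbTE /intE.
    by move=> {1}->; case: eqP.
  (* A single fractional coordinate would force [m < k < m + 1]. *)
  move: ysum; rewrite yE; set m := #|_|; move: fa => /andP[a0 a1] mk.
  have : (m%:R : R) < k%:R by rewrite -mk ltrDr.
  have : (k%:R : R) < m.+1%:R by rewrite -mk -natr1 addrC ltrD2l.
  by rewrite !ltr_nat; lia.
have step c d : c != d -> 0 < y 0 c < 1 -> 0 < y 0 d < 1 ->
    exists2 t, 0 < t & C (y + t *: (delta_mx 0 c - delta_mx 0 d)).
  move=> cd /andP[c0 c1] /andP[d0 d1].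
  (* The largest admissible shift: coordinate [c] reaches 1 or coordinate [d] reaches 0. *)
  pose t := Num.min (1 - y 0 c) (y 0 d).
  have t0 : 0 < t by rewrite lt_min subr_gt0 c1.
  have tc : t <= 1 - y 0 c by rewrite ge_min lexx.
  have td : t <= y 0 d by rewrite ge_min lexx orbT.
  have tE : y 0 c + t = 1 \/ y 0 d - t = 0.
    by rewrite /t minEle; case: ifP => _; [left|right]; ring.
  have yt i : (y + t *: (delta_mx 0 c - delta_mx 0 d)) 0 i =
      if i == c then y 0 c + t else if i == d then y 0 d - t else y 0 i.
    rewrite !mxE eqxx/=; case: (eqVneq i c) => [->|ic].
      by rewrite (negbTE cd) mulr1n mulr0n subr0 mulr1.
    by case: eqVneq => [->|_]; rewrite !(mulr0n, mulr1n); ring.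
  exists t => //; apply: IH => [|A Ak Apos|i|].
  - rewrite -ltnS; apply: leq_trans yn; rewrite ltnS; apply/proper_card.
    apply/properP; split.
      apply/fintype.subsetP => i; rewrite !inE yt.
      case: eqVneq => [->|ic]; first by rewrite c0 c1.
      by case: eqVneq => [->|//]; rewrite d0 d1.
    case: tE => tE; [exists c|exists d]; rewrite !inE ?c0 ?d0// yt ?eqxx.
      by rewrite tE ltxx andbF.
    by rewrite eq_sym (negbTE cd) tE ltxx.
  (* No new positive coordinate appears, since [c] and [d] were positive already. Thus every vertex
     used has its set inside the support of [y]. *)
  - apply: CA => // i /Apos; rewrite yt; case: eqVneq => [->//|_].
    by case: eqVneq => [->//|_].
  - rewrite yt; have := y01 i; case: (i == c); first lra.
    by case: (i == d); lra.
  - rewrite -ysum (bigD1 c)//= (bigD1 d) 1?eq_sym//= [RHS](bigD1 c)//=.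
    rewrite [X in _ = _ + X](bigD1 d) 1?eq_sym//= !yt !eqxx.
    rewrite eq_sym (negbTE cd) !addrA; congr +%R; first by ring.
    apply: eq_bigr => i /andP[/negbTE ic /negbTE id].
    by rewrite yt ic id.
have [t t0 Ct] := step _ _ ba fb fa.
have ab : a != b by rewrite eq_sym.
have [u u0 Cu] := step _ _ ab fa fb.
exact: (convex_set_shift _ _ _ _ _ _ Ccvx t0 u0 Ct Cu).
Qed.

End IntegralPoints.

(* [t] is maximal such that [u + t <= 1], [v - t >= -1] and
   [`|u + t| + `|v - t| <= K]. *)
Lemma opposite_shift {R : realFieldType} (u v K : R) :
  `|u| < 1 -> `|v| < 1 -> `|u| + `|v| < K ->
  exists t, [/\ 0 < t, `|u + t| <= 1, `|v - t| <= 1 &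
    `|u + t| + `|v - t| = K \/
    (`|u + t| + `|v - t| <= K /\ (u + t = 1 \/ v - t = -1))].
Proof.
rewrite !ltr_norml => /andP[u0 u1] /andP[v0 v1] uvK.
have [uK uK' vK vK'] : [/\ u + v < K, u - v < K, v - u < K & - u - v < K].
  by move: uvK; case: (ger0P u) => ?; case: (ger0P v) => ?; split; lra.
(* At shift [w] the absolute values sum to [K], because [u + w = (K + u + v) / 2] is positive and
   [v - w = (u + v - K) / 2] is negative. The [t] below is where the boundary of the square is met;
   the smaller of the two is the witness. *)
pose w := (K - (u - v)) / 2; have wE : u - v + w + w = K by rewrite /w; field.
pose t := Num.min (1 - u) (1 + v).
have tE : t = 1 - u /\ t <= 1 + v \/ t = 1 + v /\ t <= 1 - u.
  rewrite /t minEle; case: ifP => [|/negbT]; rewrite -?ltNge => tuv.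
    by left.
  by right; split=> //; exact: ltW.
have t0 : 0 < t by case: tE => -[-> _]; lra.
have [tu tv] : t <= 1 - u /\ t <= 1 + v by case: tE => -[-> //]; split.
clearbody w t; have [wt|tw] := leP w t.
  exists w; split; try (rewrite ler_norml; lra); first lra.
  by left; rewrite ger0_norm ?ler0_norm; lra.
exists t; split=> //; try (rewrite ler_norml; lra).
right; split; last by case: tE => -[-> _]; [left|right]; ring.
by case: (ger0P (u + t)) => ?; case: (ger0P (v - t)) => ?; lra.
Qed.

(** * Signed hypersimplices *)

Section SignedHypersimplex.
Context {R : realType} {N : nat}.
Implicit Types (C : set 'rV[R]_N) (y : 'rV[R]_N).

Definition signed_row (A B : {set 'I_N}) : 'rV[R]_N :=
  indicator_row A - indicator_row B.

(** Zero sum and l1 norm [2 * j] give the positive part [p] and the negative part [q] sum [j] each.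
    The hypersimplex argument first replaces [p] by an indicator with [q] fixed, then [q] with that
    indicator fixed. *)
Lemma signed_hypersimplex_facet_sub_convex (j : nat) C y :
  @convex_set R 'rV[R]_N C ->
  (forall A B : {set 'I_N}, #|A| = j -> #|B| = j -> [disjoint A & B]%B ->
    C (signed_row A B)) ->
  \sum_i y 0 i = 0 -> (forall i, `|y 0 i| <= 1) ->
  \sum_i `|y 0 i| = 2 * j%:R -> C y.
Proof.
move=> Ccvx CAB y0 y1 ysum.
pose p := \row_i Num.max (y 0 i) 0; pose q := \row_i Num.max (- y 0 i) 0.
have pE i : p 0 i = (`|y 0 i| + y 0 i) / 2.
  by rewrite mxE maxEle; case: (ger0P (y 0 i)) => ?; case: ifP; lra.
have qE i : q 0 i = (`|y 0 i| - y 0 i) / 2.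
  by rewrite mxE maxEle; case: (ger0P (y 0 i)) => ?; case: ifP; lra.
have psum : \sum_i p 0 i = j%:R.
  under eq_bigr do rewrite pE.
  by rewrite -mulr_suml big_split/= y0 ysum; field.
have qsum : \sum_i q 0 i = j%:R.
  under eq_bigr do rewrite qE.
  by rewrite -mulr_suml big_split/= sumrN y0 ysum; field.
have p01 i : 0 <= p 0 i <= 1.
  by rewrite pE; have := y1 i; case: (ger0P (y 0 i)) => ?; lra.
have q01 i : 0 <= q 0 i <= 1.
  by rewrite qE; have := y1 i; case: (ger0P (y 0 i)) => ?; lra.
(* The factor 1 matches the shape [x + c *: v] of the affine preimage. *)
have yE : y = - q + 1 *: p.
  by apply/rowP => i; rewrite mxE [(- q) _ _]mxE [(1 *: p) _ _]mxE pE qE; field.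
rewrite yE; apply: (hypersimplex_sub_convex j [set v | C (- q + 1 *: v)]) => //.
  exact: convex_set_affine_preimage.
move=> A Aj Apos /=.
rewrite scale1r addrC -scaleN1r.
apply: (hypersimplex_sub_convex j [set v | C (indicator_row A + (-1) *: v)]) => //.
  exact: convex_set_affine_preimage.
move=> B Bj Bpos /=; rewrite scaleN1r; apply: CAB => //.
(* [A] and [B] lie in the supports of [p] and [q], which are disjoint. *)
apply/pred0P => i /=; apply/negP => /andP[/Apos + /Bpos].
by rewrite pE qE; case: (ger0P (y 0 i)) => ?; lra.
Qed.

(** A general [f] covers both the coordinate sum and the l1 norm. *)
Lemma sum_shift y (c d : 'I_N) (t : R) (f : R -> R) : c != d ->
  \sum_i f ((y + t *: (delta_mx 0 c - delta_mx 0 d)) 0 i) =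
  \sum_i f (y 0 i) - f (y 0 c) - f (y 0 d) + f (y 0 c + t) + f (y 0 d - t).
Proof.
move=> cd.
rewrite (bigD1 c)//= (bigD1 d) 1?eq_sym//= [\sum_i f (y 0 i)](bigD1 c)//=.
rewrite [X in _ + X - _ - _](bigD1 d) 1?eq_sym//= !mxE !eqxx/=.
rewrite (eq_sym d) (negbTE cd) !(mulr0n, mulr1n).
rewrite subr0 sub0r mulr1 mulrN1 (eq_bigr (fun i => f (y 0 i))); first by ring.
move=> i /andP[/negbTE ic /negbTE id].
by rewrite !mxE ic id subr0 mulr0 addr0.
Qed.

(* With a single interior coordinate, a zero sum would make it an integer, hence
   [0], and then [N - 1] would be even and less than [2 j <= N]. *)
Lemma exists_two_interior (j : nat) y : (2 * j <= N)%N ->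
  \sum_i y 0 i = 0 -> (forall i, `|y 0 i| <= 1) -> \sum_i `|y 0 i| < 2 * j%:R ->
  exists a b, [/\ a != b, `|y 0 a| < 1 & `|y 0 b| < 1].
Proof.
move=> jN y0 y1 ysum.
have yE i : (`|y 0 i| < 1) = false -> `|y 0 i| = 1.
  by move=> /negbT; rewrite -leNgt => yi; apply/le_anti; rewrite y1.
have [/existsP[a ia]|/existsPn none] := boolP [exists i, `|y 0 i| < 1]; last first.
  exfalso; move: ysum; rewrite (eq_bigr (fun=> 1)).
    by rewrite sumr_const card_ord -natrM ltr_nat; lia.
  by move=> i _; apply/yE/negbTE.
have [/existsP[b /andP[ba ib]]|/existsPn onlya] :=
    boolP [exists b, (b != a) && (`|y 0 b| < 1)].
  by exists b, a.
exfalso; pose A := [set i in predC1 a | 0 <= y 0 i]%SET.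
have yi i : i != a -> `|y 0 i| = 1.
  by move=> ia'; have := onlya i; rewrite ia' => /negbTE /yE.
have N1 : (N.-1 < 2 * j)%N.
  rewrite -(ltr_nat R) natrM; apply: le_lt_trans ysum.
  rewrite (bigD1 a)//= (eq_bigr (fun=> 1)) => [|i]; last exact: yi.
  by rewrite sumr_const cardC1 card_ord lerDr.
have NE : N = (2 * j)%N by have := ltn_ord a; lia.
(* The other coordinates are signs, [#|A|] of them positive, and [y 0 a] is minus their sum. As
   [N = 2 * j], this is an odd integer, which cannot lie strictly between -1 and 1. *)
have ya : y 0 a = N.-1%:R - 2 * #|A|%:R.
  move: y0; rewrite (bigD1 a)//= => /eqP; rewrite addr_eq0 => /eqP ->.
  rewrite (eq_bigr (fun i => 2 * (0 <= y 0 i)%R%:R - 1 : R)) => [|i ia']; last first.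
    by have := yi i ia'; case: (ger0P (y 0 i)) => ? yi1;
      rewrite !(mulr1n, mulr0n); lra.
  rewrite big_split/= sumr_const cardC1 card_ord -mulr_sumr.
  rewrite -sum1_card natr_sum /A.
  rewrite [in RHS](eq_bigl (fun i => (i != a) && (0 <= y 0 i))%R) => [|i]; last by rewrite !inE.
  rewrite big_mkcondr/= mulNrn opprD opprK addrC; congr (_ - _ * _).
  by apply: eq_bigr => i _; case: (0 <= y 0 i).
have NR : N.-1%:R = 2 * j%:R - 1 :> R.
  have -> : N.-1 = (2 * j - 1)%N by lia.
  by rewrite natrB ?natrM//; lia.
move: ia; rewrite ya NR ltr_norml => /andP[lo hi].
have A1 : (2 * #|A| < 2 * j)%N by rewrite -(ltr_nat R) !natrM; lra.
have A2 : (2 * j < 2 * #|A| + 2)%N by rewrite -(ltr_nat R) natrD !natrM; lra.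
by lia.
Qed.

(** Induction on the number of coordinates in the open interval: each shift either raises the l1
    norm to [2 * j], the facet case, or sends a coordinate to 1 or -1. *)
Lemma signed_hypersimplex_sub_convex (j : nat) C y :
  @convex_set R 'rV[R]_N C -> (2 * j <= N)%N ->
  (forall A B : {set 'I_N}, #|A| = j -> #|B| = j -> [disjoint A & B]%B ->
    C (signed_row A B)) ->
  \sum_i y 0 i = 0 -> (forall i, `|y 0 i| <= 1) ->
  \sum_i `|y 0 i| <= 2 * j%:R -> C y.
Proof.
move=> Ccvx jN CAB; have [n] := ubnP #|[set i | `|y 0 i| < 1]%SET|.
elim: n y => // n IH y yn y0 y1 yle.
have facet := signed_hypersimplex_facet_sub_convex j C _ Ccvx CAB.
have [ysum|yneq] := eqVneq (\sum_i `|y 0 i|) (2 * j%:R); first exact: facet.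
have ylt : \sum_i `|y 0 i| < 2 * j%:R by rewrite lt_neqAle yneq.
have [a [b [ab ia ib]]] := exists_two_interior j y jN y0 y1 ylt.
have step c d : c != d -> `|y 0 c| < 1 -> `|y 0 d| < 1 ->
    exists2 t, 0 < t & C (y + t *: (delta_mx 0 c - delta_mx 0 d)).
  move=> cd c1 d1.
  (* The share of the l1 bound left to coordinates [c] and [d] by the others. *)
  pose K := 2 * j%:R - \sum_i `|y 0 i| + `|y 0 c| + `|y 0 d|.
  have Kgt : `|y 0 c| + `|y 0 d| < K by rewrite /K -addrA ltrDr subr_gt0.
  have [t [t0 ct dt tK]] := opposite_shift _ _ _ c1 d1 Kgt.
  have yt i : (y + t *: (delta_mx 0 c - delta_mx 0 d)) 0 i =
      if i == c then y 0 c + t else if i == d then y 0 d - t else y 0 i.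
    rewrite !mxE eqxx/=; case: (eqVneq i c) => [->|ic].
      by rewrite (negbTE cd) mulr1n mulr0n subr0 mulr1.
    by case: eqVneq => [->|_]; rewrite !(mulr0n, mulr1n); ring.
  have box i : `|(y + t *: (delta_mx 0 c - delta_mx 0 d)) 0 i| <= 1.
    by rewrite yt; case: eqVneq => // _; case: eqVneq.
  have sum0 : \sum_i (y + t *: (delta_mx 0 c - delta_mx 0 d)) 0 i = 0.
    by rewrite (sum_shift _ _ _ _ id)// y0; ring.
  have sumK : \sum_i `|(y + t *: (delta_mx 0 c - delta_mx 0 d)) 0 i| =
      2 * j%:R - K + (`|y 0 c + t| + `|y 0 d - t|).
    by rewrite (sum_shift _ _ _ _ Num.norm)// /K; ring.
  exists t => //; case: tK => [tK|[tK tE]].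
    by apply: facet => //; rewrite sumK tK subrK.
  apply: IH => //; last by rewrite sumK -[leRHS](subrK K) lerD2l.
  rewrite -ltnS; apply: leq_trans yn; rewrite ltnS; apply/proper_card.
  apply/properP; split.
    apply/fintype.subsetP => i; rewrite !inE yt.
    by case: eqVneq => [->|ic] //; case: eqVneq => [->|].
  case: tE => tE; [exists c|exists d]; rewrite !inE ?c1 ?d1// yt eqxx.
    by rewrite tE normr1 ltxx.
  by rewrite eq_sym (negbTE cd) tE normrN1 ltxx.
have ba : b != a by rewrite eq_sym.
have [t tgt Ct] := step _ _ ab ia ib.
have [u ugt Cu] := step _ _ ba ib ia.
exact: (convex_set_shift _ _ _ _ _ _ Ccvx tgt ugt Ct Cu).
Qed.

End SignedHypersimplex.

(** * Orbits of the generators under coordinate permutations *)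

Section Orbits.
Context {R : realType} {N : nat}.
Implicit Types (y : 'rV[R]_N).

(** Equal fiber sizes make the two lists of values permutations of each other. *)
Lemma perm_of_fibers (T : finType) (F G : 'I_N -> T) :
  (forall c, #|[set i | F i == c]%SET| = #|[set i | G i == c]%SET|) ->
  exists s : 'S_N, forall i, F i = G (s i).
Proof.
move=> FG; have cnt (H : 'I_N -> T) c :
    count_mem c [seq H i | i <- enum 'I_N] = #|[set i | H i == c]%SET|.
  by rewrite count_map cardE -size_filter enumT; congr size; apply: eq_filter => i; rewrite /= inE.
have [|s sE] := @tuple_permP _ _ [seq F i | i <- enum 'I_N] [tuple G i | i < N] _.
  by apply/allP => c _ /=; rewrite !cnt FG.
exists s => i; have := congr1 (fun l => nth (F i) l i) sE.
rewrite (nth_map i) ?size_enum_ord// nth_ord_enum => ->.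
by rewrite nth_mktuple tnth_mktuple.
Qed.

(** Finite labels in place of real entries reduce membership in an orbit to finitely many
    cardinalities, whether or not [h] is injective. *)
Lemma Sym_labelP (T : finType) (G : 'I_N -> T) (h : T -> R) x :
  Defs.Sym (\row_i h (G i)) x <->
  exists F : 'I_N -> T,
    (forall c, #|[set i | F i == c]%SET| = #|[set i | G i == c]%SET|) /\
    x = \row_i h (F i).
Proof.
split=> [[s _ <-]|[F [/perm_of_fibers[s sE] ->]]].
  exists (G \o s); split=> [c|]; last by apply/rowP => i; rewrite !mxE.
  rewrite -(card_imset _ (@perm_inj _ s)); congr #|pred_of_set _|.
  apply/setP => i; rewrite inE; apply/imsetP/idP => [[k + ->]|Gi].
    by rewrite inE.
  by exists (s^-1%g i); rewrite ?inE /= permKV.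
by exists s => //; apply/rowP => i; rewrite !mxE sE.
Qed.

Lemma card_ord_lt (k : nat) : (k <= N)%N -> #|[set i : 'I_N | (i < k)%N]%SET| = k.
Proof.
move=> kN; rewrite -sum1_card (eq_bigl (fun i : 'I_N => (i < k)%N)).
  by rewrite -(big_ord_widen N (fun=> 1%N))// sum1_card card_ord.
by move=> i; rewrite inE.
Qed.

Lemma card_setC_ord (A : {set 'I_N}) : #|~: A|%SET = (N - #|A|)%N.
Proof. by have := cardsC A; rewrite card_ord; lia. Qed.

(** [S] is the set of positions of the entry [N - k]. The chosen form exhibits the generator as an
    image of a cube vertex. *)
Lemma R_DBP (x : 'rV[R]_N) :
  @R_DB R N x <-> exists2 S : {set 'I_N}, (0 < #|S| < N)%N &
    x = N%:R *: indicator_row S - const_mx #|S|%:R.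
Proof.
have rowE k (F : 'I_N -> bool) : \row_i (if F i then N%:R - k%:R else - k%:R) =
    N%:R *: indicator_row [set i | F i]%SET - const_mx k%:R :> 'rV[R]_N.
  by apply/rowP => i; rewrite !mxE inE; case: (F i); rewrite !(mulr1n, mulr0n); ring.
split=> [[k /= kN]|[S SN ->]].
  have := Sym_labelP _ (fun i : 'I_N => (i < k)%N)
    (fun b : bool => if b then N%:R - k%:R else - k%:R) x.
  move=> [+ _] => /[apply] -[F [Fc ->]].
  have kE : #|[set i | F i]%SET| = k.
    rewrite -[RHS]card_ord_lt; last by lia.
    rewrite -[RHS](_ : #|[set i : 'I_N | (i < k)%N == true]%SET| = _).
      by rewrite -Fc; apply: eq_card => i; rewrite !inE eqb_id.
    by apply: eq_card => i; rewrite !inE eqb_id.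
  by exists [set i | F i]%SET; rewrite kE// rowE.
exists #|S| => //=; apply/(Sym_labelP _ (fun i : 'I_N => (i < #|S|)%N)
    (fun b : bool => if b then N%:R - #|S|%:R else - #|S|%:R)).
exists (fun i => i \in S); split; last first.
  by rewrite rowE; congr (_ *: indicator_row _ - _); apply/setP => i; rewrite inE.
have cT : #|[set i | i \in S]%SET| = #|[set i : 'I_N | (i < #|S|)%N]%SET|.
  by rewrite card_ord_lt ?cardsE//; lia.
case.
  by under eq_finset do rewrite eqb_id; under [in RHS]eq_finset do rewrite eqb_id.
have cC (P : pred 'I_N) : #|[set i | P i == false]%SET| = (N - #|[set i | P i]%SET|)%N.
  by rewrite -card_setC_ord; apply: eq_card => i; rewrite !inE eqbF_neg.
by rewrite !cC cT.
Qed.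

(** The labels [Some true], [Some false] and [None] stand for the signs 1, -1 and 0; the sizes of
    the first two fibers determine the third. *)
Lemma R_CSjP (j : nat) (x : 'rV[R]_N) : (2 * j <= N)%N ->
  @R_CSj R N j x <-> exists A B : {set 'I_N},
    [/\ #|A| = j, #|B| = j, [disjoint A & B]%B & x = tauj R N j *: signed_row A B].
Proof.
move=> jN; pose h (c : option bool) : R := 
  if c is Some b then (if b then tauj R N j else - tauj R N j) else 0.
pose G (i : 'I_N) := if (i < j)%N then Some true
  else if (i < 2 * j)%N then Some false else None.
have -> : @R_CSj R N j = Defs.Sym (\row_i h (G i)).
  congr Defs.Sym; apply/rowP => i; rewrite !mxE /G.
  by case: ifP => _; [|case: ifP => _]; rewrite /= ?mulr1 ?mulrN1 ?mulr0.
have GT : #|[set i | G i == Some true]%SET| = j.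
  rewrite -[RHS]card_ord_lt; last by lia.
  by apply: eq_card => i; rewrite !inE /G; do 2?case: ifP.
have GF : #|[set i | G i == Some false]%SET| = j.
  have -> : [set i | G i == Some false]%SET =
      ([set i : 'I_N | (i < 2 * j)%N] :\: [set i : 'I_N | (i < j)%N])%SET.
    by apply/setP => i; rewrite !inE /G; do 2?case: ifP.
  rewrite cardsD (finset.setIidPr _) ?card_ord_lt//; try lia.
  by apply/fintype.subsetP => i; rewrite !inE; lia.
have FN (F : 'I_N -> option bool) : #|[set i | F i == None]%SET| =
    (N - (#|[set i | F i == Some true]%SET| + #|[set i | F i == Some false]%SET|))%N.
  have <- : #|([set i | F i == Some true] :|: [set i | F i == Some false])%SET| =
    (#|[set i | F i == Some true]%SET| + #|[set i | F i == Some false]%SET|)%N.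
    apply/eqP; rewrite (leq_card_setU _ _).2.
    by apply/pred0P => i; rewrite /= !inE; case: (F i) => [[]|].
  rewrite -card_setC_ord; apply: eq_card => i; rewrite !inE.
  by case: (F i) => [[]|].
split=> [/Sym_labelP[F [Fc ->]]|[A [B [Aj Bj AB ->]]]].
  exists [set i | F i == Some true]%SET, [set i | F i == Some false]%SET.
  split; rewrite ?Fc//.
    by apply/pred0P => i; rewrite /= !inE; case: (F i) => [[]|].
  apply/rowP => i; rewrite !mxE !inE.
  by case: (F i) => [[]|] /=; rewrite ?(mulr1n, mulr0n); ring.
pose F i := if i \in A then Some true else if i \in B then Some false else None.
have FA : [set i | F i == Some true]%SET = A.
  by apply/setP => i; rewrite inE /F; do 2?case: ifP.
have FB : [set i | F i == Some false]%SET = B.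
  apply/setP => i; rewrite inE /F; case: ifP => [iA|_]; last by case: ifP.
  by rewrite (disjointFr AB iA).
apply/Sym_labelP; exists F; split=> [[[]|]|]; rewrite ?FN ?FA ?FB ?GT ?GF ?Aj ?Bj//.
apply/rowP => i; rewrite !mxE -[in LHS]FA -[in LHS]FB !inE.
by case: (F i) => [[]|] /=; rewrite ?(mulr1n, mulr0n); ring.
Qed.

End Orbits.

(** * Norms and convexity estimates *)

Section Norms.
Context {R : realType} {N : nat}.
Implicit Types (y : 'rV[R]_N).

Lemma norm_spr_leP y (c : R) : (0 < N)%N ->
  norm_spr y <= c <-> forall a b, y 0 a - y 0 b <= c.
Proof.
move=> N0; pose i0 := Ordinal N0.
have [M _ yM] := @arg_maxP _ R 'I_N i0 xpredT (fun i => y 0 i) isT.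
have [m _ ym] := @arg_minP _ R 'I_N i0 xpredT (fun i => y 0 i) isT.
have -> : norm_spr y = y 0 M - y 0 m.
  congr (_ - _); apply/le_anti/andP; split.
  - by apply: ge_sup; [exists (y 0 M), M|move=> _ [i _ <-]; exact: yM].
  - by apply: ub_le_sup; [exists (y 0 M) => _ [i _ <-]; exact: yM|exists M].
  - by apply: ge_inf; [exists (y 0 m) => _ [i _ <-]; exact: ym|exists m].
  - by apply: lb_le_inf; [exists (y 0 m), m|move=> _ [i _ <-]; exact: ym].
split=> [yc a b|]; last exact.
by apply: le_trans yc; apply: lerB; [exact: yM|exact: ym].
Qed.

(** The matrix norm is an iterated maximum starting at 0, so [c] has to bound 0 too. *)
Lemma norm_infty_leP y (c : R) : 0 <= c ->
  norm_infty y <= c <-> forall i, `|y 0 i| <= c.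
Proof.
move=> c0; rewrite /norm_infty [`|y|]mx_normrE; split=> [/bigmax_leP[_ yc] i|yc].
  exact: (yc (0, i)).
by apply/bigmax_leP; split=> // -[a i] _ /=; rewrite (ord1 a).
Qed.

(** The other entries sum to [- y 0 i], so their absolute values contribute at least as much as this
    entry. For [j = 1] the bound on single entries thus follows from the l1 bound. *)
Lemma abs_le_half_norm1 y i : zero_sum N y -> 2 * `|y 0 i| <= norm1 y.
Proof.
rewrite /zero_sum /= /norm1 (bigD1 i)//= => /eqP; rewrite addr_eq0 => /eqP yi.
rewrite (bigD1 i)//= mulr_natl mulr2n lerD2l {1}yi normrN.
exact: ler_norm_sum.
Qed.

Lemma zero_sum_convex : @convex_set R 'rV[R]_N (zero_sum N).
Proof.
apply/convex_setP => x y t; rewrite /zero_sum /= => x0 y0 _.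
under eq_bigr do rewrite !mxE.
by rewrite big_split/= -!mulr_sumr x0 y0 !mulr0 addr0.
Qed.

Lemma convex_comb_le (c u v t : R) :
  0 <= t <= 1 -> u <= c -> v <= c -> t * u + (1 - t) * v <= c.
Proof.
move=> /andP[t0 t1] uc vc; have -> : c = t * c + (1 - t) * c by ring.
by apply: lerD; apply: ler_wpM2l; rewrite ?subr_ge0.
Qed.

Lemma convex_comb_norm_le (u v t : R) : 0 <= t <= 1 ->
  `|t * u + (1 - t) * v| <= t * `|u| + (1 - t) * `|v|.
Proof.
move=> /andP[t0 t1]; apply: le_trans (ler_normD _ _) _.
by rewrite !normrM (ger0_norm t0) (ger0_norm (_ : 0 <= 1 - t)) ?subr_ge0.
Qed.

End Norms.

(** * The constants [tau] and [tauj] *)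

Section Tau.
Context {R : realType}.

(** At the angle [pi / 4] the second sine is 1 and the first is nonnegative, so the supremum is at
    least [j]. *)
Lemma tauj_gt0 (N j : nat) : (0 < j)%N -> (2 * j <= N)%N -> 0 < tauj R N j.
Proof.
move=> j0 jN; set a : R := N%:R - 2 * j%:R.
have a0 : 0 <= a by rewrite /a -natrM subr_ge0 ler_nat.
apply: (@lt_le_trans _ _ (a * sin (pi / 4) + j%:R * sin (2 * (pi / 4)))).
  have -> : 2 * (pi / 4) = pi / 2 :> R by field.
  rewrite sin_pihalf mulr1 ltr_wpDl ?ltr0n// mulr_ge0// sin_ge0_pi//.
  by have := pi_gt0 R; lra.
apply: ub_le_sup; last by exists (pi / 4).
exists (a + j%:R) => _ [phi _ <-]; apply: lerD.
  by rewrite ler_piMr// sin_le1.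
by rewrite ler_piMr// sin_le1.
Qed.

Lemma tau_tauj1 (N : nat) : tau R N = tauj R N 1.
Proof.
rewrite /tau /tauj; congr sup; apply: eq_imagel => phi _.
by rewrite mulr1 mul1r.
Qed.

Lemma R_CS_R_CSj1 (N : nat) : @R_CS R N = @R_CSj R N 1.
Proof.
rewrite /R_CS /R_CSj tau_tauj1; congr (Defs.Sym (_ *: _)).
by apply/rowP => i; rewrite !mxE muln1; case: i => -[|[|i]].
Qed.

End Tau.

(** * The convex hulls *)

Section InnerPolytopes.
Context {R : realType} {N : nat}.
Implicit Types (y : 'rV[R]_N).

Lemma I_DBE : (2 <= N)%N ->
  I_DB R N = [set y | zero_sum N y /\ forall a b, y 0 a - y 0 b <= N%:R].
Proof.
move=> N2; have N0 : N%:R != 0 :> R by rewrite pnatr_eq0; lia.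
have LE (z : 'rV[R]_N) (c : R) i : (N%:R *: z - const_mx c) 0 i = N%:R * z 0 i - c.
  by rewrite !mxE.
have DE (c d : R) (u v : 'rV[R]_N) i :
    (c *: u + d *: v) 0 i = c * u 0 i + d * v 0 i by rewrite !mxE.
apply/seteqP; split.
  apply: convex_hull_sub.
    apply/convex_setP => x y t [x0 xN] [y0 yN] t01; split.
      by move/convex_setP: (@zero_sum_convex R N); apply.
    move=> a b; rewrite !mxE.
    have := convex_comb_le _ _ _ _ t01 (xN a b) (yN a b).
    by congr (_ <= _); ring.
  move=> x /R_DBP[S SN ->]; split.
    rewrite /zero_sum /= (eq_bigr _ (fun i _ => LE _ _ i)) sumrB -mulr_sumr.
    by rewrite sum_indicator_row sumr_const card_ord mulr_natl subrr.
  move=> a b; rewrite !mxE opprD opprK addrACA addNr addr0 -mulrBr.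
  rewrite ler_piMr//.
  by case: (a \in S); case: (b \in S) => /=; lra.
move=> y [y0 yN].
(* [L] maps the indicator of a proper nonempty set to a generator. *)
pose L (z : 'rV[R]_N) : 'rV[R]_N := N%:R *: z - const_mx (\sum_i z 0 i).
have Lind S : L (indicator_row S) = N%:R *: indicator_row S - const_mx #|S|%:R.
  by rewrite /L sum_indicator_row.
have Lgen (S : {set _}) : (0 < #|S| < N)%N -> I_DB R N (L (indicator_row S)).
  by move=> SN; apply: sub_convex_hull; apply/R_DBP; exists S => //; rewrite Lind.
pose i0 : 'I_N := Ordinal (ltnW N2).
have /convex_setP hullcvx := convex_hull_convex (@R_DB R N).
(* Needed because [L] sends the indicators of the empty and the full set to 0. Complementary sets
   give opposite generators, whose midpoint is 0. *)
have hull0 : I_DB R N 0.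
  have cC : #|~: [set i0]%SET|%SET = N.-1 by rewrite card_setC_ord cards1 subn1.
  have -> : 0 = 2^-1 *: L (indicator_row [set i0]%SET) +
      (1 - 2^-1) *: L (indicator_row (~: [set i0])%SET).
    apply/rowP => i; rewrite !Lind DE !LE cards1 cC [LHS]mxE.
    rewrite -subn1 natrB; last by lia.
    rewrite [indicator_row _ _ _]mxE [in X in _ = _ + X]mxE !inE.
    by case: eqVneq => _ /=; rewrite !(mulr1n, mulr0n); field.
  by apply: hullcvx; [apply: Lgen; rewrite cards1; lia|apply: Lgen; rewrite cC; lia|lra].
have [m _ ym] := @arg_minP _ R 'I_N i0 xpredT (fun i => y 0 i) isT.
(* [L] kills constant rows, and [y] has zero sum. The spread bound puts the new entries in the unit
   interval. *)
have -> : y = L (\row_i ((y 0 i - y 0 m) / N%:R)).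
  apply/rowP => i; rewrite LE; under eq_bigr do rewrite mxE.
  rewrite -mulr_suml sumrB sumr_const card_ord.
  by move: y0; rewrite /zero_sum /= => ->; rewrite mxE -[y 0 m *+ N]mulr_natl; field.
apply: (cube_sub_convex [set v | I_DB R N (L v)]).
- apply/convex_setP => u v t /= Iu Iv t01.
  have -> : L (t *: u + (1 - t) *: v) = t *: L u + (1 - t) *: L v.
    apply/rowP => i; rewrite DE !LE.
    under eq_bigr do rewrite !mxE.
    by rewrite big_split/= -!mulr_sumr !mxE; ring.
  exact: hullcvx.
- move=> S /=; have [SN|] := boolP (0 < #|S| < N)%N; first exact: Lgen.
  rewrite negb_and -leqNgt leqn0 -leqNgt => SN.
  have -> : L (indicator_row S) = 0; last exact: hull0.
  apply/rowP => i; rewrite Lind LE !mxE.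
  have [->|S0] := eqVneq S finset.set0; first by rewrite cards0 inE mulr0 subrr.
  have ST : S = finset.setT.
    apply/eqP; rewrite eqEcard finset.subsetT cardsT card_ord.
    by move: SN; rewrite cards_eq0 (negbTE S0).
  by rewrite ST inE cardsT card_ord mulr1 subrr.
- move=> i; rewrite mxE divr_ge0 ?subr_ge0 ?ym//=.
  by rewrite ler_pdivrMr ?mul1r ?yN// ltr0n; lia.
Qed.

Lemma I_CSjE (j : nat) : (0 < j)%N -> (2 * j <= N)%N ->
  I_CSj R N j = [set y | [/\ zero_sum N y, norm1 y <= 2 * j%:R * tauj R N j &
     forall i, `|y 0 i| <= tauj R N j]].
Proof.
move=> j0 jN; have t0 := @tauj_gt0 R N j j0 jN; set t := tauj R N j in t0 *.
apply/seteqP; split.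
  apply: convex_hull_sub.
    apply/convex_setP => x y s [x0 x1 xi] [y0 y1 yi] s01; split.
    - by move/convex_setP: (@zero_sum_convex R N); apply.
    - apply: le_trans (convex_comb_le _ _ _ _ s01 x1 y1).
      rewrite /norm1 !mulr_sumr -big_split/=; apply: ler_sum => i _.
      by rewrite !mxE; exact: convex_comb_norm_le.
    - move=> i; rewrite !mxE; apply: le_trans (convex_comb_norm_le _ _ _ s01) _.
      exact: convex_comb_le.
  move=> x /(R_CSjP _ _ jN)[A [B [Aj Bj AB ->]]].
  have rowi i : (t *: signed_row A B) 0 i = t * ((i \in A)%:R - (i \in B)%:R).
    by rewrite !mxE.
  (* Disjointness turns the absolute value of a difference of indicators into their sum. *)
  have absi i : `|(t *: signed_row A B) 0 i| = t * ((i \in A)%:R + (i \in B)%:R).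
    rewrite rowi normrM (gtr0_norm t0); congr (_ * _).
    have [iA|_] := boolP (i \in A); last by rewrite sub0r normrN add0r normr_nat.
    by rewrite (disjointFr AB iA) subr0 addr0 normr_nat.
  have sumS (S : {set 'I_N}) : \sum_i (i \in S)%:R = #|S|%:R :> R.
    by rewrite -sum_indicator_row; apply: eq_bigr => i _; rewrite mxE.
  split.
  - rewrite /zero_sum /=; under eq_bigr do rewrite rowi.
    by rewrite -mulr_sumr sumrB !sumS Aj Bj subrr mulr0.
  - rewrite /norm1; under eq_bigr do rewrite absi.
    by rewrite -mulr_sumr big_split/= !sumS Aj Bj mulrC mulr_natl mulr2n.
  - move=> i; rewrite absi ler_piMr ?(ltW t0)//.
    have [iA|_] := boolP (i \in A); last first.
      by rewrite -natrD lern1 leq_b1.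
    by rewrite (disjointFr AB iA) addr0.
move=> y [y0 y1 yi].
have -> : y = 0 + t *: (t^-1 *: y).
  by rewrite add0r scalerA divff ?scale1r// gt_eqF.
apply: (signed_hypersimplex_sub_convex j [set v | I_CSj R N j (0 + t *: v)]) => //.
- exact/convex_set_affine_preimage/convex_hull_convex.
- move=> A B Aj Bj AB /=; rewrite add0r; apply: sub_convex_hull.
  by apply/R_CSjP => //; exists A, B.
- under eq_bigr do rewrite mxE.
  by rewrite -mulr_sumr; move: y0; rewrite /zero_sum /= => ->; rewrite mulr0.
- move=> i; rewrite mxE normrM gtr0_norm ?invr_gt0//.
  by rewrite ler_pdivrMl// mulr1.
- under eq_bigr do rewrite mxE normrM gtr0_norm ?invr_gt0//.
  by rewrite -mulr_sumr ler_pdivrMl// mulrC.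
Qed.

End InnerPolytopes.

(** * Sums of the largest and smallest entries *)

Section SortedSums.
Context {R : realType} {N : nat}.
Implicit Types (y : 'rV[R]_N) (S T : {set 'I_N}).

(** Subtract the minimum of [y] over [T], which changes both sums equally: terms in [T] become
    nonnegative and terms outside it nonpositive. *)
Lemma sum_le_top_set y S T : #|S| = #|T| ->
  (forall i k, i \in T -> k \notin T -> y 0 k <= y 0 i) ->
  \sum_(i in S) y 0 i <= \sum_(i in T) y 0 i.
Proof.
move=> ST yT; have [T0|[i0 i0T]] := set_0Vmem T.
  move: ST; rewrite T0 cards0 => /eqP; rewrite cards_eq0 => /eqP ->.
  by rewrite !big_set0.
have [m mT ym] := @arg_minP _ R 'I_N i0 [in T] (fun i => y 0 i) i0T.
suff : \sum_(i in S) (y 0 i - y 0 m) <= \sum_(i in T) (y 0 i - y 0 m).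
  by rewrite !sumrB !sumr_const ST lerD2r.
rewrite big_mkcond [leRHS]big_mkcond/=; apply: ler_sum => i _.
case: ifPn => iS; case: ifPn => iT //; first by rewrite subr_le0 yT.
by rewrite subr_ge0 ym.
Qed.

Lemma sum_ge_bottom_set y S T : #|S| = #|T| ->
  (forall i k, i \in T -> k \notin T -> y 0 i <= y 0 k) ->
  \sum_(i in T) y 0 i <= \sum_(i in S) y 0 i.
Proof.
move=> ST yT; rewrite -lerN2 -!sumrN.
have := sum_le_top_set (- y) S T ST; under eq_bigr do rewrite mxE.
under [in X in _ <= X]eq_bigr do rewrite mxE; apply.
by move=> i k iT kT; rewrite !mxE lerN2 yT.
Qed.

(** [T] and [B] are the first and last [j] indices in one list of all indices by decreasing value,
    which settles ties consistently. *)
Lemma sorted_extremal_sets y (j : nat) : (2 * j <= N)%N ->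
  exists T B : {set 'I_N}, [/\ #|T| = j, #|B| = j, [disjoint T & B]%B &
  [/\ \sum_(1 <= l < j.+1) ymax y l = \sum_(i in T) y 0 i,
      \sum_(1 <= l < j.+1) ymin y l = \sum_(i in B) y 0 i,
      forall i k, i \in T -> k \notin T -> y 0 k <= y 0 i &
      forall i k, i \in B -> k \notin B -> y 0 i <= y 0 k]].
Proof.
move=> jN; pose e := sort (relpre (y 0) >=%R) (enum 'I_N).
have yge : total (relpre (y 0) >=%R) by move=> a b; exact: le_total.
have e_perm : perm_eq e (enum 'I_N) by rewrite perm_sort.
have e_size : size e = N by rewrite size_sort size_enum_ord.
have e_uniq : uniq e by rewrite sort_uniq enum_uniq.
have e_mem i : i \in e by rewrite mem_sort mem_enum.
have e_sorted : pairwise (relpre (y 0) >=%R) e.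
  rewrite -sorted_pairwise ?sort_sorted// => a b c ab bc.
  exact: le_trans bc ab.
have sE : sort >=%R (codom (y 0)) = [seq y 0 i | i <- e].
  by rewrite codomE sort_map.
(* The increasing sort is the reverse of the decreasing one, so [e] serves both sums. *)
have sE' : sort <=%R (codom (y 0)) = rev [seq y 0 i | i <- e].
  apply: (@sorted_eq _ <=%R); [exact: le_trans|exact: le_anti| | |].
  - by apply: sort_sorted; exact: le_total.
  - by rewrite rev_sorted -sE sort_sorted// => a b; exact: le_total.
  - by rewrite perm_sort perm_sym perm_rev -sE perm_sort.
(* Ranks start at 1, hence the shift by one; [j <= size s] keeps the default of [nth] from being
   read. *)
have sumE (s : seq R) : (j <= size s)%N ->
    \sum_(1 <= l < j.+1) nth 0 s l.-1 = \sum_(x <- take j s) x.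
  move=> js; rewrite big_add1/= [RHS](big_nth 0) size_takel//.
  by apply: eq_big_nat => i ij; rewrite nth_take//.
have cutP n i k : i \in take n e -> k \in drop n e -> y 0 k <= y 0 i.
  move: e_sorted; rewrite -{1}(cat_take_drop n e) pairwise_cat.
  by move=> /andP[/allrelP ye _]; exact: ye.
have cut_uniq n : uniq (take n e) /\ uniq (drop n e) /\
    [disjoint take n e & drop n e]%B.
  move: e_uniq; rewrite -{1}(cat_take_drop n e) cat_uniq => /and3P[-> td ->].
  by split=> //; split=> //; rewrite disjoint_sym disjoint_has.
have cut_mem n i : (i \in take n e) || (i \in drop n e).
  by rewrite -mem_cat cat_take_drop.
have setE (s : seq 'I_N) : uniq s -> #|[set i in s]%SET| = size s.
  by move=> us; rewrite cardsE; exact/card_uniqP.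
have sumset (s : seq 'I_N) : uniq s ->
    \sum_(i <- s) y 0 i = \sum_(i in [set i in s]%SET) y 0 i.
  by move=> us; rewrite big_uniq//; apply: eq_bigl => i; rewrite inE.
exists [set i in take j e]%SET, [set i in drop (N - j) e]%SET; split.
- by rewrite setE ?(cut_uniq _).1// size_takel// e_size; lia.
- by rewrite setE ?(cut_uniq _).2.1// size_drop e_size; lia.
- have [_ [_ dj]] := cut_uniq j; apply/pred0P => i /=; rewrite !inE.
  apply/negP => /andP[ti di].
  (* As [2 * j <= N], the last [j] places come after the first [j]. *)
  suff : i \in drop j e by rewrite (disjointFr dj ti).
  by move: di; rewrite (_ : N - j = (N - j - j) + j)%N -?drop_drop; [exact: mem_drop|lia].
split.
- rewrite /ymax sE sumE ?size_map ?e_size; last lia.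
  by rewrite -map_take big_map sumset// (cut_uniq _).1.
- rewrite /ymin sE' sumE ?size_rev ?size_map ?e_size; last lia.
  rewrite take_rev size_map e_size (perm_big _ (permEl (perm_rev _))).
  by rewrite -map_drop big_map sumset// (cut_uniq _).2.1.
- move=> i k; rewrite !inE => it kt; apply: cutP it _.
  by have := cut_mem j k; rewrite (negbTE kt).
- move=> i k; rewrite !inE => id kd; apply: (cutP (N - j)%N) => //.
  by have := cut_mem (N - j)%N k; rewrite (negbTE kd) orbF.
Qed.

(** Each sum is bounded separately, so overlapping [A] and [B] are covered. *)
Lemma sum_sub_le_extremal y (j : nat) (A B : {set 'I_N}) :
  (2 * j <= N)%N -> #|A| = j -> #|B| = j ->
  \sum_(i in A) y 0 i - \sum_(i in B) y 0 i <=
  \sum_(1 <= l < j.+1) ymax y l - \sum_(1 <= l < j.+1) ymin y l.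
Proof.
move=> jN Aj Bj.
have [T [S [Tj Sj _ [-> -> yT yS]]]] := sorted_extremal_sets y j jN.
apply: lerB; first by apply: sum_le_top_set; rewrite ?Aj.
by apply: sum_ge_bottom_set; rewrite ?Bj.
Qed.

End SortedSums.

(** * The circumscribed polytopes *)

Section CircumscribedPolytopes.
Context {R : realType} {N : nat}.
Implicit Types (y : 'rV[R]_N) (S A B : {set 'I_N}).

Lemma sum_mul_indicator y S :
  \sum_i y 0 i * (i \in S)%:R = \sum_(i in S) y 0 i.
Proof.
by rewrite [RHS]big_mkcond; apply: eq_bigr => i _; case: (i \in S); rewrite /= ?mulr1 ?mulr0.
Qed.

(** The constant row is orthogonal to every zero-sum row. *)
Lemma dot_R_DB y S : zero_sum N y ->
  dot y (N%:R *: indicator_row S - const_mx #|S|%:R) = N%:R * \sum_(i in S) y 0 i.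
Proof.
rewrite /zero_sum /= => y0; rewrite /dot -sum_mul_indicator mulr_sumr.
rewrite (eq_bigr (fun i => N%:R * (y 0 i * (i \in S)%:R) - y 0 i * #|S|%:R)).
  by rewrite sumrB -mulr_suml y0 mul0r subr0.
by move=> i _; rewrite !mxE; ring.
Qed.

Lemma dot_R_CSj y A B (t : R) :
  dot y (t *: signed_row A B) = t * (\sum_(i in A) y 0 i - \sum_(i in B) y 0 i).
Proof.
rewrite /dot -!sum_mul_indicator -sumrB mulr_sumr; apply: eq_bigr => i _.
by rewrite !mxE; ring.
Qed.

(** An empty intersection would be the whole space; a member of [X] supplies the zero sum. *)
Lemma polyCE (X : set 'rV[R]_N) : X !=set0 ->
  Defs.polyC X = [set y | zero_sum N y /\ forall x, X x -> dot y x <= dot x x].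
Proof.
move=> [x0 Xx0]; apply/seteqP; split=> [y Xy|y [y0 yX] x Xx]; last by split; auto.
by split=> [|x Xx]; [have [] := Xy _ Xx0|have [] := Xy _ Xx].
Qed.

Lemma Sym_nonempty (x : 'rV[R]_N) : Defs.Sym x !=set0.
Proof. by exists (col_perm 1%g x), 1%g. Qed.

(** With [k = #|S|], the generator has squared norm [N * k * (N - k)], and the factor [N] cancels
    against the inner product with [y]. *)
Lemma C_DBP y : (2 <= N)%N ->
  C_DB R N y <-> zero_sum N y /\ forall S, (0 < #|S| < N)%N ->
    \sum_(i in S) y 0 i <= #|S|%:R * (N%:R - #|S|%:R).
Proof.
move=> N2; have N0 : 0 < N%:R :> R by rewrite ltr0n; lia.
rewrite /C_DB polyCE; last first.
  have [x xS] := Sym_nonempty (\row_(i < N) if (i < 1)%N then N%:R - 1%:R else - 1%:R).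
  by exists x, 1%N.
have dotSS S : dot (N%:R *: indicator_row S - const_mx #|S|%:R)
    (N%:R *: indicator_row S - const_mx #|S|%:R) =
    N%:R * (#|S|%:R * (N%:R - #|S|%:R)) :> R.
  rewrite dot_R_DB; last first.
    rewrite /zero_sum /= (eq_bigr (fun i => N%:R * indicator_row S 0 i - #|S|%:R)).
      by rewrite sumrB -mulr_sumr sum_indicator_row sumr_const card_ord mulr_natl subrr.
    by move=> i _; rewrite !mxE.
  congr (_ * _); rewrite (eq_bigr (fun=> N%:R - #|S|%:R)) ?sumr_const ?mulr_natl//.
  by move=> i iS; rewrite !mxE iS mulr1.
split=> -[y0 yS]; split=> //.
  move=> S SN; rewrite -(ler_pM2l N0) -dot_R_DB// -dotSS.
  by apply: yS; apply/R_DBP; exists S.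
by move=> x /R_DBP[S SN ->]; rewrite dotSS dot_R_DB// ler_pM2l// yS.
Qed.

(** The generators have squared norm [2 * j] times the square of [tauj]; one positive factor [tauj]
    cancels. *)
Lemma C_CSjP (j : nat) y : (0 < j)%N -> (2 * j <= N)%N ->
  C_CSj R N j y <-> zero_sum N y /\ forall A B, #|A| = j -> #|B| = j ->
    [disjoint A & B]%B ->
    \sum_(i in A) y 0 i - \sum_(i in B) y 0 i <= 2 * j%:R * tauj R N j.
Proof.
move=> j0 jN; have t0 := @tauj_gt0 R N j j0 jN.
rewrite /C_CSj polyCE; last exact: Sym_nonempty.
have dotAB A B : #|A| = j -> #|B| = j -> [disjoint A & B]%B ->
    dot (tauj R N j *: signed_row A B) (tauj R N j *: signed_row A B) =
    tauj R N j * (2 * j%:R * tauj R N j).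
  move=> Aj Bj AB; rewrite dot_R_CSj; congr (_ * _).
  rewrite (eq_bigr (fun=> tauj R N j)); last first.
    by move=> i iA; rewrite !mxE iA (disjointFr AB iA) subr0 mulr1.
  rewrite [X in _ - X](eq_bigr (fun=> - tauj R N j)); last first.
    by move=> i iB; rewrite !mxE iB (disjointFl AB iB) sub0r mulrN1.
  by rewrite sumrN !sumr_const Aj Bj opprK -[_ *+ j]mulr_natl; ring.
split=> -[y0 yAB]; split=> //.
  move=> A B Aj Bj AB; rewrite -(ler_pM2l t0) -dot_R_CSj -(dotAB A B)//.
  by apply: yAB; apply/R_CSjP => //; exists A, B.
move=> x /(R_CSjP _ _ jN)[A [B [Aj Bj AB ->]]].
by rewrite dotAB// dot_R_CSj ler_pM2l// yAB.
Qed.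

(** The extremal top and bottom sets are disjoint, so the sorted difference is itself one of the
    constraints and dominates the rest. *)
Lemma C_CSj_sortedP (j : nat) y : (0 < j)%N -> (2 * j <= N)%N ->
  C_CSj R N j y <-> zero_sum N y /\
    \sum_(1 <= l < j.+1) ymax y l - \sum_(1 <= l < j.+1) ymin y l
      <= 2 * j%:R * tauj R N j.
Proof.
move=> j0 jN; rewrite C_CSjP//; split=> -[y0 yle]; split=> //.
  have [T [B [Tj Bj TB [-> -> _ _]]]] := sorted_extremal_sets y j jN.
  exact: yle.
by move=> A B Aj Bj _; exact: le_trans (sum_sub_le_extremal _ _ _ _ jN Aj Bj) yle.
Qed.

Lemma C_CSj_setsP (j : nat) y : (0 < j)%N -> (2 * j <= N)%N ->
  C_CSj R N j y <-> zero_sum N y /\ forall A B, #|A| = j -> #|B| = j ->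
    \sum_(i in A) y 0 i - \sum_(i in B) y 0 i <= 2 * j%:R * tauj R N j.
Proof.
move=> j0 jN; split=> [|[y0 yle]]; last by apply/C_CSjP => //; split=> //; auto.
move=> /C_CSj_sortedP-/(_ j0 jN)[y0 yle]; split=> // A B Aj Bj.
exact: le_trans (sum_sub_le_extremal _ _ _ _ jN Aj Bj) yle.
Qed.

End CircumscribedPolytopes.

(** * Maxima as pointwise bounds, and the assembled descriptions *)

Lemma bigmaxe_nat_leP {R : realType} (a b : nat) (F : nat -> \bar R) (c : R) :
  (\big[maxe/-oo]_(a <= k < b) F k <= c%:E)%E <->
  forall k, (a <= k < b)%N -> (F k <= c%:E)%E.
Proof.
split=> [Fc k kab|Fc]; last first.
  by rewrite big_nat_cond; apply: bigmax_le => [|k /andP[/Fc]]; rewrite ?leNye.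
apply: le_trans Fc; apply: le_bigmax_seq => //.
by rewrite mem_index_iota.
Qed.

Lemma bigmaxe_leP {R : realType} (I : finType) (P : pred I) (F : I -> \bar R) (c : R) :
  (\big[maxe/-oo]_(i | P i) F i <= c%:E)%E <-> forall i, P i -> (F i <= c%:E)%E.
Proof.
split=> [/bigmax_leP[_ //]|Fc].
by apply/bigmax_leP; split=> //; rewrite leNye.
Qed.

Theorem proposition3p6 (R : realType) (N j : nat)
    (hN : (2 <= N)%N) (hj1 : (1 <= j)%N) (hjN : (2 * j <= N)%N) :
  I_DB R N = [set y | zero_sum N y /\ norm_spr y <= N%:R] /\
  I_CS R N = [set y | zero_sum N y /\ norm1 y <= 2 * tau R N] /\
  I_CSj R N j =
    [set y | zero_sum N y /\
       Num.max (j%:R^-1 * norm1 y) (2 * norm_infty y) <= 2 * tauj R N j] /\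
  C_DB R N =
    [set y | zero_sum N y /\
       (\big[maxe/-oo]_(1 <= k < N) \big[maxe/-oo]_(S : {set 'I_N} | #|S| == k)
          ((\sum_(l in S) y 0 l) / (k%:R * (N%:R - k%:R)))%:E <= 1)%E] /\
  C_CS R N = [set y | zero_sum N y /\ norm_spr y <= 2 * tau R N] /\
  C_CSj R N j =
    [set y | zero_sum N y /\
       \sum_(1 <= l < j.+1) ymax y l - \sum_(1 <= l < j.+1) ymin y l
         <= 2 * j%:R * tauj R N j] /\
  \bigcap_(i in [set i | (1 <= i <= N./2)%N]) C_CSj R N i =
    [set y | zero_sum N y /\
       (\big[maxe/-oo]_(1 <= k < (N./2).+1)
          \big[maxe/-oo]_(S1 : {set 'I_N} | #|S1| == k)
          \big[maxe/-oo]_(S2 : {set 'I_N} | #|S2| == k)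
          ((\sum_(i in S1) y 0 i - \sum_(i in S2) y 0 i)
             / (2 * k%:R * tauj R N k))%:E <= 1)%E].
Proof.
have N0 : (0 < N)%N by exact: ltnW.
have le_spr (y : 'rV[R]_N) c : norm_spr y <= c <-> forall a b : 'I_N, y 0 a - y 0 b <= c.
  exact: norm_spr_leP.
have I_CSjE' i : (0 < i)%N -> (2 * i <= N)%N -> I_CSj R N i =
    [set y | zero_sum N y /\
       Num.max (i%:R^-1 * norm1 y) (2 * norm_infty y) <= 2 * tauj R N i].
  move=> i0 iN; have t0 := ltW (@tauj_gt0 R N i i0 iN).
  rewrite I_CSjE//; apply/seteqP.
  (* The positive factors [i] and 2 are cleared from the two bounds. *)
  have maxE (y : 'rV[R]_N) : (Num.max (i%:R^-1 * norm1 y) (2 * norm_infty y) <= 2 * tauj R N i)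
      = (norm1 y <= 2 * i%:R * tauj R N i) && (norm_infty y <= tauj R N i).
    rewrite ge_max ler_pM2l// ler_pdivrMl ?ltr0n//; congr ((_ <= _) && _).
    by ring.
  split=> y /=; rewrite maxE.
    by move=> [y0 y1 yi]; split=> //; apply/andP; split=> //; apply/norm_infty_leP.
  by move=> [y0 /andP[y1 /norm_infty_leP-/(_ t0)]].
split; [|split; [|split; [|split; [|split; [|split]]]]].
- rewrite I_DBE//; apply/seteqP; split=> y /=; rewrite le_spr; exact.
- rewrite /I_CS R_CS_R_CSj1 -/(I_CSj R N 1) I_CSjE//; apply/seteqP.
  split=> y /=; rewrite tau_tauj1 mulr1 => -[y0 y1]; split=> // i.
  by have := abs_le_half_norm1 y i y0; lra.
- exact: I_CSjE'.
- have C_DBE y := C_DBP y hN; apply/seteqP; split=> y /=.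
    move=> /C_DBE[y0 yS]; split=> //; apply/bigmaxe_nat_leP => k kN.
    apply/bigmaxe_leP => S /eqP Sk; rewrite lee_fin ler_pdivrMr ?mul1r.
      by rewrite -Sk; apply: yS; rewrite Sk.
    by rewrite mulr_gt0 ?subr_gt0 ?ltr0n ?ltr_nat; lia.
  move=> [y0 /bigmaxe_nat_leP yS]; apply/C_DBE; split=> // S SN.
  have /bigmaxe_leP/(_ S (eqxx _)) := yS _ SN.
  rewrite lee_fin ler_pdivrMr ?mul1r//.
  by rewrite mulr_gt0 ?subr_gt0 ?ltr0n ?ltr_nat; lia.
- rewrite /C_CS R_CS_R_CSj1 -/(C_CSj R N 1); apply/seteqP; split=> y /=.
    move=> /C_CSj_setsP-/(_ isT hN)[y0 yAB]; split=> //; apply/le_spr => a b.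
    have := yAB [set a]%SET [set b]%SET; rewrite !big_set1 mulr1 tau_tauj1.
    by apply; rewrite cards1.
  move=> [y0 /le_spr yab]; apply/C_CSj_setsP => //; split=> // A B.
  (* For [j = 1] the sets are singletons and the constraints are the differences of entries. *)
  move=> /eqP/cards1P[a ->] /eqP/cards1P[b ->].
  by rewrite !big_set1 mulr1 -tau_tauj1.
- by apply/seteqP; split=> y /=; rewrite C_CSj_sortedP.
- have kP k : (1 <= k < (N./2).+1)%N -> (0 < k)%N /\ (2 * k <= N)%N by lia.
  have den k : (1 <= k < (N./2).+1)%N -> 0 < 2 * k%:R * tauj R N k.
    by move=> /kP[k0 kN]; rewrite !mulr_gt0 ?ltr0n ?tauj_gt0.
  apply/seteqP; split=> y /=.
    move=> yC; split.
      (* The index 1 occurs because [N >= 2]; its polytope yields the zero sum. *)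
      have N1 : (1 <= 1 < (N./2).+1)%N by lia.
      have [k0 kN] := kP _ N1.
      by have /C_CSj_setsP-/(_ k0 kN)[] := yC 1%N N1.
    apply/bigmaxe_nat_leP => k kN; have [k0 kN2] := kP k kN.
    have /C_CSj_setsP-/(_ k0 kN2)[_ yAB] := yC k kN.
    apply/bigmaxe_leP => A /eqP Ak; apply/bigmaxe_leP => B /eqP Bk.
    by rewrite lee_fin ler_pdivrMr ?mul1r ?yAB ?den.
  move=> [y0 /bigmaxe_nat_leP yAB] k kN; have [k0 kN2] := kP k kN.
  apply/C_CSj_setsP => //; split=> // A B /eqP Ak /eqP Bk.
  have /bigmaxe_leP/(_ A Ak)/bigmaxe_leP/(_ B Bk) := yAB k kN.
  by rewrite lee_fin ler_pdivrMr ?mul1r ?den.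
Qed.
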